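(* Let $1<p<2$, $q=1/p$, and let $k\ge1$ be an integer. Then the maximum of $P_k(y) = \sum_{i=1}^k y_i^q \prod_{j\ne i}(1-y_j)^q$ over $y\in\Delta_k$ is attained either at a standard basis vector (where $P_k=1$) or at the vector $(1/k,\dots,1/k)$ (where $P_k=\theta(k)$). In particular $w(k,p)=\max\{1,\theta(k)\}$.
   Context: $\Delta_k=\{y\in\mathbb R^k: y_i\ge 0,\ \sum_i y_i=1\}$; $w(k,p)=\max_{y\in\Delta_k}P_k(y)$. For integer $k\ge2$, $\theta(k) = k\left(\frac{(k-1)^{k-1}}{k^k}\right)^q$, and $\theta(1)=1$. *)

(* Defs.v *)
From HB Require Import structures.
From mathcomp Require Import all_boot all_order all_algebra.
From mathcomp Require Import all_classical all_reals all_analysis.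
Set Implicit Arguments. Unset Strict Implicit. Unset Printing Implicit Defensive.
Import Order.TTheory GRing.Theory Num.Theory.
Local Open Scope ring_scope.
Local Open Scope classical_set_scope.

Definition simplex (R : realType) (k : nat) (y : 'I_k -> R) : Prop :=
  (forall i, 0 <= y i) /\ \sum_(i < k) y i = 1.

Definition Pk (R : realType) (k : nat) (q : R) (y : 'I_k -> R) : R :=
  \sum_(i < k) (y i `^ q * \prod_(j < k | j != i) ((1 - y j) `^ q)).

Definition theta (R : realType) (q : R) (k : nat) : R :=
  if k == 1%N then 1
  else k%:R * (((k.-1)%:R ^+ k.-1 / (k%:R ^+ k)) `^ q).

Definition w (R : realType) (k : nat) (p : R) : R :=
  sup [set Pk p^-1 y | y in [set y : 'I_k -> R | simplex y]].

Definition basisv (R : realType) (k : nat) (i : 'I_k) : 'I_k -> R :=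
  fun j => (j == i)%:R.
Definition unifv (R : realType) (k : nat) : 'I_k -> R := fun _ => k%:R^-1.
Arguments basisv R {k} i.
Arguments unifv : clear implicits.

(* Main.v *)
Require Import Defs.
From HB Require Import structures.
From mathcomp Require Import all_boot all_order all_algebra.
From mathcomp Require Import all_classical all_reals all_analysis.
From mathcomp Require Import ring lra zify.
Import Order.TTheory GRing.Theory Num.Theory.
Import numFieldNormedType.Exports.
Local Open Scope ring_scope.

Set Implicit Arguments.
Unset Strict Implicit.
Unset Printing Implicit Defensive.

(** Write x_i = y_i / (1 - y_i) and T = \sum_i x_i ^ q.  A maximizer exists by
    compactness.  Suppose that it is not a vertex; then every y_i < 1.

    Every y_i is positive, because moving a small mass e onto a zero coordinate
    gains a term of order e ^ q and loses only O(e).  Moving mass between two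
    coordinates gives the first-order condition h x_i = h x_j, where
    h x = x ^ (q - 1) + 2 x ^ q + x ^ (q + 1) - T x, and the second-order
    condition h' x_i <= 0 when y_i = y_j.  Since h' is increasing, h takes equal
    values at no more than two points and h' > 0 at the larger one; so at most
    one coordinate exceeds the smallest one.

    It remains to bound the value at (1 - N a, a, ..., a), with N = k - 1 and
    0 < a < 1 / (N + 1).  The derivative in a has the sign of
    L a = (2 q - 1) ln a + (1 - q) ln (1 - N a) - q ln (1 - a) + q ln N,
    which vanishes at 1 / (N + 1), while L' a has the sign of an affine decreasing
    function of a.  So L cannot be positive and later negative: the value first
    decreases and then increases, and it is at most its values at the two ends,
    which are 1 and theta k. *)

(** * Calculus tools: mean values, real powers, and second-order conditions *)

Section RealAnalysis.
Context {R : realType}.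
Implicit Types (f df : R -> R) (a b c r x : R).

Lemma is_derive_powR_comp f (df x r : R) : 0 < f x -> is_derive x 1 f df ->
  is_derive x 1 (fun z => f z `^ r) (r * f x `^ (r - 1) * df).
Proof. by move=> fx0 dfx; exact: (is_derive1_comp (is_derive1_powR r fx0) dfx).
Qed.

Lemma mvt_derivable f df a b : a < b ->
  (forall x, a <= x <= b -> is_derive x 1 f (df x)) ->
  exists2 c, a < c < b & f b - f a = df c * (b - a).
Proof.
move=> ab dfx; have [x /[!in_itv]||c /[!in_itv]] := @MVT _ f df a b ab.
- by move=> /andP[/ltW ax /ltW xb]; apply: dfx; rewrite ax.
- apply: derivable_within_continuous => x /[!in_itv]/= xab.
  by case: (dfx x xab).
- by exists c.
Qed.

Lemma mvt_increase f df a b : a < b ->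
  (forall x, a <= x <= b -> is_derive x 1 f (df x)) -> f a < f b ->
  exists2 c, a < c < b & 0 < df c.
Proof.
move=> ab /(mvt_derivable ab)[c cab eqc] fab; exists c => //.
by move: fab; rewrite -subr_gt0 eqc pmulr_lgt0// subr_gt0.
Qed.

Lemma mvt_decrease f df a b : a < b ->
  (forall x, a <= x <= b -> is_derive x 1 f (df x)) -> f b < f a ->
  exists2 c, a < c < b & df c < 0.
Proof.
move=> ab /(mvt_derivable ab)[c cab eqc] fab; exists c => //.
by move: fab; rewrite -subr_lt0 eqc pmulr_llt0// subr_gt0.
Qed.

(* The absolute value matters: [x `^ r] is [1] for [x < 0], so [powR] itself is
   not continuous at [0]. *)
Lemma continuous_normr_powR r : 0 < r -> continuous (fun x : R => `|x| `^ r).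
Proof.
move=> r0 x; have [->|x0] := eqVneq x 0; last first.
  apply: (@continuous_comp _ _ _ (fun x : R => `|x|) (fun x => x `^ r)).
    exact: norm_continuous.
  have nx0 : 0 < `|x| by rewrite normr_gt0.
  apply: differentiable_continuous; apply/derivable1_diffP.
  by case: (is_derive1_powR r nx0).
apply/cvgrPdist_le => e e0; near=> z.
rewrite normr0 powR0 ?gt_eqF// sub0r normrN ger0_norm ?powR_ge0//.
have -> : e = (e `^ r^-1) `^ r by rewrite -powRrM mulVf ?gt_eqF// powRr1 ?ltW.
apply: ge0_ler_powR; rewrite ?nnegrE ?powR_ge0 ?normr_ge0 ?(ltW r0)//.
near: z; exists (e `^ r^-1) => [|z]; first exact: powR_gt0.
by rewrite /= sub0r normrN => /ltW.
Unshelve. all: by end_near. Qed.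

(** If [d2 > 0], then [df], which vanishes at [c], is positive just to the right of [c], and the
    mean value theorem pushes [f] above its maximum [f c]. *)
Lemma deriv2_max_le0 f df c (d2 d : R) : 0 < d ->
  (forall x, c - d < x < c + d -> is_derive x 1 f (df x)) ->
  (forall x, c - d < x < c + d -> f x <= f c) ->
  is_derive c 1 df d2 -> df c = 0 /\ d2 <= 0.
Proof.
move=> d0 dfx fmax [dd <-].
have cd : c - d < c < c + d by lra.
have df0 : df c = 0.
  have cab : c - d <= c + d by lra.
  have := @derive1_at_max R f (c - d) (c + d) c cab.
  case=> [x /[!in_itv] /dfx[] //|/[!in_itv] //|x /[!in_itv] /fmax //|_ <-].
  by case: (dfx c cd).
split=> //; rewrite leNgt; apply/negP => d2_gt0.
have : (\forall h \near 0^', 0 < h^-1 *: (df (h *: 1 + c) - df c))%classic.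
  by have /cvgr_gt := dd; apply.
rewrite near_withinE => /nbhs_ballP[e /= e0 pos].
pose m := Num.min e d / 2.
have m_bnd : [/\ 0 < m, m < e & m < d].
  have : 0 < Num.min e d by rewrite lt_min e0.
  rewrite /m; have : Num.min e d <= e by rewrite ge_min lexx.
  have : Num.min e d <= d by rewrite ge_min lexx orbT.
  by move=> *; split; lra.
case: m_bnd => m0 me md.
have [|x xint|x /andP[x1 x2] eqx] := @mvt_derivable f df c (c + m); first lra.
  by apply: dfx; lra.
have := pos (x - c); rewrite /ball/= sub0r normrN gtr0_norm ?subr_gt0//.
have xc0 : x - c != 0 by rewrite gt_eqF// subr_gt0.
move=> /(_ _ xc0); rewrite scaler1 subrK df0 subr0 => h.
have : 0 < (x - c)^-1 * df x by apply: h; lra.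
rewrite pmulr_rgt0 ?invr_gt0 ?subr_gt0// => dfx0.
have : f (c + m) <= f c by apply: fmax; lra.
rewrite -subr_le0 eqx addrAC subrr add0r => /(lt_le_trans _).
by move=> /(_ 0 (mulr_gt0 dfx0 m0)); rewrite ltxx.
Qed.

End RealAnalysis.

(** * Exchange of mass between two coordinates *)

Section PairExchange.
Context {R : realType}.
Implicit Types (f g : R -> R) (a b c r x y z q t T : R).

Lemma is_derive_add f g x (df dg : R) : is_derive x 1 f df ->
  is_derive x 1 g dg -> is_derive x 1 (fun z => f z + g z) (df + dg).
Proof. exact: is_deriveD. Qed.

Lemma is_derive_mul f g x (df dg : R) : is_derive x 1 f df ->
  is_derive x 1 g dg ->
  is_derive x 1 (fun z => f z * g z) (f x * dg + g x * df).
Proof. exact: is_deriveM. Qed.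

Lemma is_derive_scale f x (df c : R) : is_derive x 1 f df ->
  is_derive x 1 (fun z => c * f z) (c * df).
Proof. exact: is_deriveZ. Qed.

Lemma is_derive_affine x (c d : R) : is_derive x 1 (fun z => c + d * z) d.
Proof.
apply: (is_derive_eq (is_derive_add (is_derive_cst c x 1)
  (is_derive_scale d (is_derive_id x 1)))).
by rewrite add0r mulr1.
Qed.

Lemma is_derive_powR_affine x (c d r : R) : 0 < c + d * x ->
  is_derive x 1 (fun z => (c + d * z) `^ r) (r * (c + d * x) `^ (r - 1) * d).
Proof. by move=> ?; apply: is_derive_powR_comp; [|exact: is_derive_affine]. Qed.

Lemma powR_split x r s : 0 < x -> x `^ (r + s) = x `^ r * x `^ s.
Proof. by move=> x0; rewrite powRD// (gt_eqF x0) implybT. Qed.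

Lemma powR_subr1 x r : 0 < x -> x `^ (r - 1) = x `^ r / x.
Proof. by move=> x0; rewrite powR_split// powR_inv1// ltW. Qed.

(** [T] stands for the sum of all [x_i ^ q] at the maximizer; it is the same for every coordinate
    and stays constant under differentiation in [x]. *)
Definition hfun q T x : R := x `^ (q - 1) + 2 * x `^ q + x `^ (q + 1) - T * x.
Definition hslope q T x : R :=
  (q - 1) * x `^ (q - 2) + 2 * q * x `^ (q - 1) + (q + 1) * x `^ q - T.

Lemma is_derive_powR_eq x r s : 0 < x -> s = r - 1 ->
  is_derive x 1 (fun z => z `^ r) (r * x `^ s).
Proof. by move=> x0 ->; exact: is_derive1_powR. Qed.

Lemma is_derive_hfun q T x : 0 < x ->
  is_derive x 1 (hfun q T) (hslope q T x).
Proof.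
move=> x0.
have e1 : q - 2 = q - 1 - 1 by ring.
have e2 : q = q + 1 - 1 by ring.
have H := is_derive_add (is_derive_add (is_derive_add
  (is_derive_powR_eq x0 e1) (is_derive_scale 2 (is_derive1_powR q x0)))
  (is_derive_powR_eq x0 e2)) (is_derive_scale (- T) (is_derive_id x 1)).
apply: (is_derive_eq (near_eq_is_derive _ H)); last by rewrite /hslope; ring.
by near=> z; rewrite /hfun mulNr.
Unshelve. all: by end_near. Qed.

Lemma is_derive_hslope q T x : 0 < x -> is_derive x 1 (hslope q T)
  (x `^ (q - 3) * ((1 - q) * (2 - q) - 2 * q * (1 - q) * x
    + q * (q + 1) * x ^+ 2)).
Proof.
move=> x0.
have e1 : q - 3 = q - 2 - 1 by ring.
have e2 : q - 2 = q - 1 - 1 by ring.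
have H := is_derive_add (is_derive_add (is_derive_add
  (is_derive_scale (q - 1) (is_derive_powR_eq x0 e1))
  (is_derive_scale (2 * q) (is_derive_powR_eq x0 e2)))
  (is_derive_scale (q + 1) (is_derive1_powR q x0)))
  (is_derive_cst (- T) x 1).
apply: (is_derive_eq H).
have -> : x `^ (q - 1) = x `^ (q - 3) * x ^+ 2.
  by rewrite -powR_mulrn ?(ltW x0)// -powR_split//; congr (_ `^ _); ring.
have -> : x `^ (q - 2) = x `^ (q - 3) * x.
  by rewrite -{3}(powRr1 (ltW x0)) -powR_split//; congr (_ `^ _); ring.
ring.
Qed.

Lemma hslope_lt q T x y : 0 < q < 1 -> 0 < x < y ->
  hslope q T x < hslope q T y.
Proof.
move=> /andP[q0 q1] /andP[x0 xy].
pose d z := z `^ (q - 3) * ((1 - q) * (2 - q) - 2 * q * (1 - q) * z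
  + q * (q + 1) * z ^+ 2).
have [z /andP[z0 _]|z /andP[xz _] eqz] :=
    @mvt_derivable _ (hslope q T) d _ _ xy.
  exact/is_derive_hslope/(lt_le_trans x0).
have z0 : 0 < z := lt_trans x0 xz.
rewrite -subr_gt0 eqz mulr_gt0 ?subr_gt0// mulr_gt0 ?powR_gt0//.
(* The quadratic is a sum of squares plus the positive constant [2 * (1 - q) ^ 2]. *)
have -> : (1 - q) * (2 - q) - 2 * q * (1 - q) * z + q * (q + 1) * z ^+ 2 =
  (1 - q) * (q * (z - 1) ^+ 2 + 2 * (1 - q)) + 2 * (q * z) ^+ 2 by ring.
apply: ltr_pwDl; last by rewrite mulr_ge0 ?sqr_ge0.
apply: mulr_gt0; first by rewrite subr_gt0.
by apply: ltr_wpDl; [rewrite mulr_ge0 ?sqr_ge0 ?ltW | rewrite mulr_gt0 ?subr_gt0].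
Qed.

Lemma hfun_eq_slope q T x y : 0 < x < y -> hfun q T x = hfun q T y ->
  exists2 z, x < z < y & hslope q T z = 0.
Proof.
move=> /andP[x0 xy] hxy.
have [z /andP[z0 _]|z xzy] := @mvt_derivable _ (hfun q T) (hslope q T) _ _ xy.
  exact/is_derive_hfun/(lt_le_trans x0).
rewrite hxy subrr => /esym/eqP; rewrite mulf_eq0 [y - x == 0]gt_eqF ?subr_gt0//.
by rewrite orbF => /eqP; exists z.
Qed.

(** By Rolle's theorem the slope vanishes somewhere between [x] and [y], and it increases strictly
    from there to [y]. *)
Lemma hfun_eq_slope_gt0 q T x y : 0 < q < 1 -> 0 < x < y ->
  hfun q T x = hfun q T y -> 0 < hslope q T y.
Proof.
move=> q01 xy /(hfun_eq_slope xy)[z /andP[xz zy] <-].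
by apply: hslope_lt => //; rewrite zy (lt_trans _ xz)//; case/andP: xy.
Qed.

(** Since its slope increases, [hfun] is strictly convex on the positive reals, so no value is taken
    three times. *)
Lemma hfun_three_points q T x y z : 0 < q < 1 -> 0 < x < y -> y < z ->
  hfun q T x = hfun q T y -> hfun q T y != hfun q T z.
Proof.
move=> q01 xy yz hxy; apply/eqP => hyz.
have y0 : 0 < y by case/andP: xy => x0; exact: lt_trans.
have [||s /andP[ys _] s0] := @hfun_eq_slope q T y z; [by rewrite y0|by []|].
have := hfun_eq_slope_gt0 q01 xy hxy.
have : hslope q T y < hslope q T s by apply: hslope_lt; rewrite // y0.
by rewrite s0 => /lt_trans h /h; rewrite ltxx.
Qed.

(* With the other coordinates fixed, the objective is a positive multiple of
   [pair_value q t y_i y_j], where [t] is the sum of the other [x_l `^ q]. *)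
Definition pair_value q t a b : R :=
  (a * (1 - b)) `^ q + (b * (1 - a)) `^ q + t * ((1 - a) * (1 - b)) `^ q.

(** Shifting mass [e] from [b] to [a] gives a function of [e] with an interior maximum at 0. Its
    first derivative there is a positive multiple of [hfun q T x - hfun q T z]; when [a = b], its
    second derivative is one of [hslope q T x]. *)
Lemma pair_max_critical q a b t : 0 < q -> 0 < a < 1 -> 0 < b < 1 ->
  (forall a' b', 0 <= a' -> 0 <= b' -> a' + b' = a + b ->
    pair_value q t a' b' <= pair_value q t a b) ->
  let x := a / (1 - a) in let z := b / (1 - b) in
  let T := t + x `^ q + z `^ q in
  hfun q T x = hfun q T z /\ (a = b -> hslope q T x <= 0).
Proof.
move=> q0 /andP[a0 a1] /andP[b0 b1] tmax x z T.
(* With [a' = a + e] and [b' = b - e], these are the bases [a' (1 - b')], [b' (1 - a')] and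
   [(1 - a') (1 - b')]. The explicit coefficients fit [is_derive_affine]. *)
pose U (e : R) : R := (a + 1 * e) * (1 - b + 1 * e).
pose V (e : R) : R := (b + (- 1) * e) * (1 - a + (- 1) * e).
pose W (e : R) : R := (1 - a + (- 1) * e) * (1 - b + 1 * e).
pose dU (e : R) : R := 1 + a - b + 2 * e.
pose dV (e : R) : R := a - b - 1 + 2 * e.
pose dW (e : R) : R := b - a + (- 2) * e.
have DU (e : R) : is_derive e 1 U (dU e).
  apply: (is_derive_eq (is_derive_mul (is_derive_affine _ _ _)
    (is_derive_affine _ _ _))); rewrite /dU; ring.
have DV (e : R) : is_derive e 1 V (dV e).
  apply: (is_derive_eq (is_derive_mul (is_derive_affine _ _ _)
    (is_derive_affine _ _ _))); rewrite /dV; ring.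
have DW (e : R) : is_derive e 1 W (dW e).
  apply: (is_derive_eq (is_derive_mul (is_derive_affine _ _ _)
    (is_derive_affine _ _ _))); rewrite /dW; ring.
pose F (e : R) : R := U e `^ q + V e `^ q + t * W e `^ q.
pose D (e : R) : R := q * U e `^ (q - 1) * dU e + q * V e `^ (q - 1) * dV e
  + t * (q * W e `^ (q - 1) * dW e).
pose d := Num.min (Num.min a b) (Num.min (1 - a) (1 - b)).
have d0 : 0 < d by rewrite !lt_min a0 b0 !subr_gt0 a1.
have /and4P[da db da1 db1] : [&& d <= a, d <= b, d <= 1 - a & d <= 1 - b].
  by rewrite !ge_min !lexx !orbT.
have pos (e : R) : 0 - d < e < 0 + d -> [/\ 0 < U e, 0 < V e & 0 < W e].
  by move=> /andP[e1 e2]; split; apply: mulr_gt0; lra.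
have DF (e : R) : 0 - d < e < 0 + d -> is_derive e 1 F (D e).
  move=> /pos[Ue Ve We].
  exact: (is_derive_add (is_derive_add (is_derive_powR_comp q Ue (DU e))
    (is_derive_powR_comp q Ve (DV e)))
    (is_derive_scale t (is_derive_powR_comp q We (DW e)))).
have /pos[U0 V0 W0] : 0 - d < 0 < 0 + d by lra.
have Fmax (e : R) : 0 - d < e < 0 + d -> F e <= F 0.
  move=> /andP[e1 e2]; have := tmax (a + e) (b - e).
  rewrite /pair_value /F /U /V /W; do ![rewrite mulr0|rewrite addr0].
  have -> : 1 - (b - e) = 1 - b + 1 * e by ring.
  have -> : 1 - (a + e) = 1 - a + (- 1) * e by ring.
  rewrite mul1r mulN1r; apply; lra.
have DD := is_derive_add (is_derive_add
    (is_derive_mul (is_derive_scale q (is_derive_powR_comp (q - 1) U0 (DU 0)))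
      (is_derive_affine 0 (1 + a - b) 2))
    (is_derive_mul (is_derive_scale q (is_derive_powR_comp (q - 1) V0 (DV 0)))
      (is_derive_affine 0 (a - b - 1) 2)))
  (is_derive_scale t
    (is_derive_mul (is_derive_scale q (is_derive_powR_comp (q - 1) W0 (DW 0)))
      (is_derive_affine 0 (b - a) (- 2)))).
have [D0 D20] := deriv2_max_le0 d0 DF Fmax DD.
have x0 : 0 < x by rewrite divr_gt0 ?subr_gt0.
have z0 : 0 < z by rewrite divr_gt0 ?subr_gt0.
have na : 1 - a != 0 by rewrite gt_eqF ?subr_gt0.
have nb : 1 - b != 0 by rewrite gt_eqF ?subr_gt0.
have eU : U 0 = x * W 0 by rewrite /U /W /x; field.
have eV : V 0 = z * W 0 by rewrite /V /W /z; field.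
have ex1 : 1 + x = (1 - a)^-1 by rewrite /x; field.
have ez1 : 1 + z = (1 - b)^-1 by rewrite /z; field.
have ea : a = x / (1 + x) by rewrite ex1 invrK /x mulfVK.
have eb : b = z / (1 + z) by rewrite ez1 invrK /z mulfVK.
have eW : W 0 = ((1 + x) * (1 + z))^-1.
  by rewrite ex1 ez1 invfM !invrK /W !mulr0 !addr0.
have nx : 1 + x != 0 by rewrite gt_eqF// addr_gt0.
have nz : 1 + z != 0 by rewrite gt_eqF// addr_gt0.
have w0 : W 0 `^ (q - 1) != 0 by rewrite gt_eqF ?powR_gt0.
have xq1 : x `^ q = x * x `^ (q - 1) by rewrite mulr_powRB1 ?ltW.
have zq1 : z `^ q = z * z `^ (q - 1) by rewrite mulr_powRB1 ?ltW.
rewrite -/x -/z in T *; clearbody x z.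
have xq2 : x `^ (q + 1) = x * x `^ q by rewrite powR_split// powRr1 ?ltW// mulrC.
have zq2 : z `^ (q + 1) = z * z `^ q by rewrite powR_split// powRr1 ?ltW// mulrC.
split.
  (* The common factor [q * W 0 ^ (q - 1)] is cancelled from [D 0 = 0]; multiplication by
     [(1 + x) (1 + z)] then yields [hfun q T x - hfun q T z]. *)
  have : x `^ (q - 1) * dU 0 + z `^ (q - 1) * dV 0 + t * dW 0 = 0.
    apply: (mulfI w0); apply: (mulfI (lt0r_neq0 q0)); rewrite !mulr0 -[RHS]D0.
    rewrite /D eU eV (powRM _ (ltW x0) (ltW W0)) (powRM _ (ltW z0) (ltW W0)). ring.
  move=> /(congr1 (fun u => (1 + x) * (1 + z) * u)); rewrite mulr0.
  rewrite /dU /dV /dW ea eb => E.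
  apply/eqP; rewrite -subr_eq0; apply/eqP; rewrite -[RHS]E.
  by rewrite /hfun /T xq2 zq2 xq1 zq1; field; rewrite nx nz.
move=> ab.
have zx : z = x.
  have : (1 + z)^-1 = (1 + x)^-1 by rewrite ex1 ez1 ab.
  by move=> /(congr1 (fun u => u^-1 - 1)); rewrite !invrK !(addrC 1) !addrK.
have xqq : x `^ (q - 2) = x `^ (q - 1) / x.
  by rewrite -powR_subr1//; congr (_ `^ _); ring.
have UV : V 0 = U 0 by rewrite eU eV zx.
have dU1 : dU 0 = 1 by rewrite /dU ab; ring.
have dV1 : dV 0 = - 1 by rewrite /dV ab; ring.
have dW1 : dW 0 = 0 by rewrite /dW ab; ring.
have eU1 : U 0 `^ (q - 1) = x `^ (q - 1) * W 0 `^ (q - 1).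
  by rewrite eU (powRM _ (ltW x0) (ltW W0)).
have : 2 * q * W 0 `^ (q - 1) * hslope q T x <= 0.
  move: D20; congr (_ <= 0); rewrite dU1 dV1 dW1 UV (powR_subr1 (q - 1) U0) eU1 eU.
  rewrite [W 0 in X in _ / X]eW /hslope /T xqq zx xq1.
  by rewrite ab; field; rewrite nx gt_eqF.
by rewrite pmulr_rle0// !mulr_gt0// powR_gt0.
Qed.


End PairExchange.

(** * The one-parameter family with one large coordinate *)

Section OneLarge.
Context {R : realType}.
Implicit Types (q N a x r : R).

(** This is [Pk] at [(1 - N a, a, ..., a)], with [N] standing for [k - 1] as a real number; see
    [Pk_one_large]. *)
Definition one_large q N a : R := (1 - N * a) `^ q * (1 - a) `^ (q * N)
  + N `^ (1 + q) * (a `^ (2 * q) * (1 - a) `^ (q * (N - 1))).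

(** The logarithm of the ratio of the two terms in the last factor of [one_large_slope]. *)
Definition one_large_sign q N x : R :=
  (2 * q - 1) * ln x + (1 - q) * ln (1 - N * x) - q * ln (1 - x) + q * ln N.

Definition one_large_slope q N x : R :=
  q * N * (1 - x) `^ (q * N - q - 1) * (2 - (N + 1) * x)
  * (N `^ q * x `^ (2 * q - 1) - (1 - N * x) `^ (q - 1) * (1 - x) `^ q).

Lemma one_large_range N x : 1 <= N -> 0 < x <= (N + 1)^-1 ->
  [/\ 0 < x, 0 < 1 - N * x, 0 < 1 - x & 0 < 2 - (N + 1) * x].
Proof.
move=> N1 /andP[x0 xc].
have N2 : 0 < N + 1 by lra.
have : x * (N + 1) <= 1 by rewrite -ler_pdivlMr ?div1r.
have : 0 < x * N by rewrite mulr_gt0//; lra.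
by split=> //; lra.
Qed.

Lemma is_derive_one_large q N x : 0 < q -> 1 <= N -> 0 < x <= (N + 1)^-1 ->
  is_derive x 1 (one_large q N) (one_large_slope q N x).
Proof.
move=> q0 N1 xc; have [x0 y0 z0 _] := one_large_range N1 xc.
have y0' : 0 < 1 + (- N) * x by rewrite mulNr.
have z0' : 0 < 1 + (- 1) * x by rewrite mulN1r.
have H := is_derive_add (is_derive_mul (is_derive_powR_affine q y0')
  (is_derive_powR_affine (q * N) z0'))
  (is_derive_scale (N `^ (1 + q)) (is_derive_mul (is_derive1_powR (2 * q) x0)
    (is_derive_powR_affine (q * (N - 1)) z0'))).
apply: (is_derive_eq (near_eq_is_derive _ H)).
  by near=> z; rewrite /one_large mulNr mulN1r.
have N0 : 0 < N by lra.
rewrite mulNr mulN1r /one_large_slope.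
rewrite (powR_split 1 q N0) powRr1 ?(ltW N0)//.
rewrite -(mulr_powRB1 (ltW x0) (_ : 0 < 2 * q)); last lra.
rewrite -(mulr_powRB1 (ltW y0) q0).
have -> : q * N - 1 = (q * N - q - 1) + q by ring.
have -> : (1 - x) `^ (q * N) = (1 - x) `^ ((q * N - q - 1) + q + 1).
  by congr (_ `^ _); ring.
have -> : q * (N - 1) - 1 = q * N - q - 1 by ring.
have -> : (1 - x) `^ (q * (N - 1)) = (1 - x) `^ (q * N - q - 1 + 1).
  by congr (_ `^ _); ring.
by rewrite !(powR_split _ _ z0) (powRr1 (ltW z0)); ring.
Unshelve. all: by end_near. Qed.

Lemma one_large_slope_sign q N x : 0 < q -> 1 <= N -> 0 < x <= (N + 1)^-1 ->
  (0 < one_large_slope q N x) = (0 < one_large_sign q N x) /\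
  (one_large_slope q N x < 0) = (one_large_sign q N x < 0).
Proof.
move=> q0 N1 xc; have [x0 y0 z0 t0] := one_large_range N1 xc.
have N0 : 0 < N by lra.
have K0 : 0 < q * N * (1 - x) `^ (q * N - q - 1) * (2 - (N + 1) * x).
  by rewrite !mulr_gt0 ?powR_gt0.
rewrite /one_large_slope pmulr_rgt0// pmulr_rlt0// subr_gt0 subr_lt0.
(* Written as exponentials, the two products compare as their exponents, whose difference is
   [one_large_sign]. *)
rewrite /powR !gt_eqF// -!expRD !ltr_expR.
by split; apply/idP/idP; rewrite /one_large_sign; lra.
Qed.

Lemma is_derive_ln_affine x (u v : R) : 0 < u + v * x ->
  is_derive x 1 (fun z => ln (u + v * z)) ((u + v * x)^-1 * v).
Proof.
move=> y0; apply: (@is_derive1_comp _ (@ln R) (fun z => u + v * z)).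
  exact: is_derive1_ln.
exact: is_derive_affine.
Qed.

(** Over the common denominator the quadratic terms cancel, which leaves a numerator affine in
    [x]. *)
Lemma is_derive_one_large_sign q N x : 1 <= N -> 0 < x <= (N + 1)^-1 ->
  is_derive x 1 (one_large_sign q N)
    (((2 * q - 1) - x * (q * (N + 1) - 1)) / (x * (1 - N * x) * (1 - x))).
Proof.
move=> N1 xc; have [x0 y0 z0 _] := one_large_range N1 xc.
have y0' : 0 < 1 + (- N) * x by rewrite mulNr.
have z0' : 0 < 1 + (- 1) * x by rewrite mulN1r.
have H := is_derive_add (is_derive_add (is_derive_add
  (is_derive_scale (2 * q - 1) (is_derive1_ln x0))
  (is_derive_scale (1 - q) (is_derive_ln_affine y0')))
  (is_derive_scale (- q) (is_derive_ln_affine z0')))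
  (is_derive_cst (q * ln N) x 1).
apply: (is_derive_eq (near_eq_is_derive _ H)).
  by near=> z; rewrite /one_large_sign /= !mulNr !mul1r.
rewrite mulNr mulN1r; field.
by rewrite !gt_eqF.
Unshelve. all: by end_near. Qed.

(** At this point [1 - N x = x] and [1 - x = N x], so the logarithms cancel. *)
Lemma one_large_sign_uniform q N : 1 <= N -> one_large_sign q N (N + 1)^-1 = 0.
Proof.
move=> N1; have N2 : 0 < N + 1 by lra.
have c0 : 0 < (N + 1)^-1 by rewrite invr_gt0.
have nN : N + 1 != 0 by rewrite gt_eqF.
rewrite /one_large_sign.
have -> : 1 - N * (N + 1)^-1 = (N + 1)^-1 by field.
have -> : 1 - (N + 1)^-1 = N * (N + 1)^-1 by field.
by rewrite lnM ?posrE//; [ring|lra].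
Qed.

Lemma powR_le1 x r : 0 < x -> x <= 1 -> 0 <= r -> x `^ r <= 1.
Proof. by move=> x0 x1 r0; rewrite -(powRr0 x) ger_powR// x0. Qed.

(** A small positive [e] replaces the end [a = 0], where the value is 1 but which the derivative
    formulas, stated for [x > 0], do not reach. *)
Lemma one_large_near0 q N a : 2^-1 < q -> q < 1 -> 1 <= N ->
  0 < a < (N + 1)^-1 -> 1 < one_large q N a ->
  exists2 e, 0 < e < a & one_large q N e < one_large q N a.
Proof.
move=> q12 q1 N1 /andP[a0 ac] h1.
have N0 : 0 < N by lra.
have C0 : 0 < N `^ (1 + q) by rewrite powR_gt0.
(* The first term of [one_large q N e] is at most 1 and the second at most [N ^ (1 + q) * e], as
   [2 q > 1] and [e <= 1]; so [e] is chosen below the excess over 1 divided by [N ^ (1 + q)]. *)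
pose m := Num.min a ((one_large q N a - 1) / N `^ (1 + q)).
have m0 : 0 < m by rewrite lt_min a0 divr_gt0// subr_gt0.
have ma : m <= a by rewrite ge_min lexx.
have mC : m <= (one_large q N a - 1) / N `^ (1 + q) by rewrite ge_min lexx orbT.
exists (m / 2); first by lra.
set e := m / 2.
have e0 : 0 < e by rewrite /e; lra.
have [|_ y0 z0 _] := @one_large_range N e N1; first by rewrite e0 /e; lra.
have y1 : 1 - N * e <= 1 by rewrite gerBl mulr_ge0 ?ltW.
have z1 : 1 - e <= 1 by rewrite gerBl ltW.
have e1 : e <= 1 by lra.
have : e < (one_large q N a - 1) / N `^ (1 + q) by rewrite /e; lra.
rewrite ltr_pdivlMr// ltrBrDl; apply: le_lt_trans.
rewrite /one_large lerD//.
  by rewrite mulr_ile1 ?powR_ge0 ?powR_le1 ?mulr_ge0//; lra.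
rewrite mulrC ler_pM2r// -[leRHS]mulr1 ler_pM ?powR_ge0 ?powR_le1 ?mulr_ge0//.
  by apply: ge1r_powR; lra.
all: lra.
Qed.

(** A violation gives [x < y] with [one_large_sign] positive at [x] and negative at [y]; as it
    returns to 0 at [(N + 1)^-1], its derivative is negative at some [u] and positive at a later
    [v], against the decreasing affine numerator. *)
Lemma one_large_le q N a : 2^-1 < q -> q < 1 -> 1 <= N -> 0 < a < (N + 1)^-1 ->
  one_large q N a <= Num.max 1 (one_large q N (N + 1)^-1).
Proof.
move=> q12 q1 N1 ac; rewrite leNgt gt_max; apply/negP => /andP[h1 hc].
have q0 : 0 < q by lra.
have [e /andP[e0 ea] he] := one_large_near0 q12 q1 N1 ac h1.
case/andP: ac => a0 ac.
have N2 : 0 < N + 1 by lra.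
have D x : 0 < x -> x <= (N + 1)^-1 ->
    is_derive x 1 (one_large q N) (one_large_slope q N x).
  by move=> x0 xc; apply: is_derive_one_large; rewrite // x0.
pose dL x :=
  ((2 * q - 1) - x * (q * (N + 1) - 1)) / (x * (1 - N * x) * (1 - x)).
have DL x : 0 < x -> x <= (N + 1)^-1 -> is_derive x 1 (one_large_sign q N) (dL x).
  by move=> x0 xc; apply: is_derive_one_large_sign; rewrite // x0.
have sgn x (x0 : 0 < x) (xc : x <= (N + 1)^-1) :=
  @one_large_slope_sign q N x q0 N1 (introT andP (conj x0 xc)).
have dLsgn x : 0 < x -> x <= (N + 1)^-1 ->
    (0 < dL x) = (0 < (2 * q - 1) - x * (q * (N + 1) - 1)) /\
    (dL x < 0) = ((2 * q - 1) - x * (q * (N + 1) - 1) < 0).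
  move=> x0 xc; have [|_ y0 z0 _] := @one_large_range N x N1; first by rewrite x0.
  by rewrite /dL pmulr_lgt0 ?pmulr_llt0// invr_gt0 !mulr_gt0.
have [x /andP[ex xa]|x /andP[ex xa]] :=
    @mvt_increase _ _ (one_large_slope q N) _ _ ea _ he.
  by apply: D; lra.
have [x_gt0 x_le] : 0 < x /\ x <= (N + 1)^-1 by split; lra.
rewrite (sgn x x_gt0 x_le).1 => Lx.
have [y /andP[ya yc]|y /andP[ay yc]] :=
    @mvt_decrease _ _ (one_large_slope q N) _ _ ac _ hc.
  by apply: D; lra.
have [y_gt0 y_le] : 0 < y /\ y <= (N + 1)^-1 by split; lra.
rewrite (sgn y y_gt0 y_le).2 => Ly.
have xy : x < y by lra.
have [u /andP[xu uy]|u /andP[xu uy]] :=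
    @mvt_decrease _ _ dL _ _ xy _ (lt_trans Ly Lx).
  by apply: DL; lra.
have [u_gt0 u_le] : 0 < u /\ u <= (N + 1)^-1 by split; lra.
rewrite (dLsgn u u_gt0 u_le).2 => Du.
rewrite -(one_large_sign_uniform q N1) in Ly.
have [v /andP[yv vc]|v /andP[yv vc]] :=
    @mvt_increase _ _ dL _ _ yc _ Ly.
  by apply: DL; lra.
have [v_gt0 v_le] : 0 < v /\ v <= (N + 1)^-1 by split; lra.
rewrite (dLsgn v v_gt0 v_le).1 => Dv.
have uv : u < v by lra.
have : 0 < q * (N + 1) - 1 by nra.
nra.
Qed.

End OneLarge.

(** * Special points of the simplex and existence of a maximizer *)

Section Simplex.
Context {R : realType} {k : nat}.
Implicit Types (q : R) (y z : 'I_k -> R) (i j : 'I_k).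

Lemma simplex_le1 y i : simplex y -> 0 <= y i <= 1.
Proof.
move=> [y0 y1]; rewrite y0 -y1 (bigD1 i)//= lerDl.
by apply: sumr_ge0.
Qed.

Lemma simplex_eq1 y i : simplex y -> y i = 1 -> y = basisv R i.
Proof.
move=> [y0 ysum] yi; apply/funext => j; rewrite /basisv.
have [->//|ji] := eqVneq j i.
have /psumr_eq0P : \sum_(l < k | l != i) y l = 0.
  by move: ysum; rewrite (bigD1 i)//= yi => /(canRL (addKr _)); rewrite addNr.
by move=> ->.
Qed.

Lemma simplex_basisv i : simplex (basisv R i).
Proof.
split=> [j|]; first by rewrite ler0n.
rewrite (bigD1 i)//= /basisv eqxx big1 ?addr0// => j /negPf ->.
by [].
Qed.

Lemma simplex_unifv : (0 < k)%N -> simplex (unifv R k).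
Proof.
move=> k0; split=> [j|]; first by rewrite invr_ge0.
by rewrite /unifv sumr_const card_ord -[_ *+ k]mulr_natr mulVf// pnatr_eq0 -lt0n.
Qed.

Lemma Pk_basisv q i : 0 < q -> Pk q (basisv R i) = 1.
Proof.
move=> q0; rewrite /Pk (bigD1 i)//= /basisv eqxx powR1 mul1r.
rewrite big1 => [|j /negPf ->]; last by rewrite subr0 powR1.
rewrite big1 ?addr0// => j /negPf ->.
by rewrite powR0 ?gt_eqF// mul0r.
Qed.

Lemma Pk_unifv q : (0 < k)%N -> Pk q (unifv R k) = theta q k.
Proof.
move=> k0; rewrite /Pk /theta /unifv.
(* For [k = 1] the product is empty and [theta] is 1 by convention. *)
case: eqP => [k1|/eqP k1].
  rewrite (eq_bigr (fun=> 1)) => [|i _].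
    by rewrite sumr_const card_ord k1.
  have -> : k%:R^-1 = 1 :> R by rewrite k1 invr1.
  rewrite powR1 mul1r big_pred0// => j; apply/negbTE; rewrite negbK.
  by apply/eqP/val_inj => /=; have := ltn_ord i; have := ltn_ord j; lia.
have kR : 0 < k%:R :> R by rewrite ltr0n.
rewrite (eq_bigr (fun=> ((k.-1)%:R ^+ k.-1 / k%:R ^+ k) `^ q)) => [|i _].
  by rewrite sumr_const card_ord mulr_natl.
have ki : 1 - k%:R^-1 = k.-1%:R / k%:R :> R.
  by rewrite -subn1 natrB// mulrBl divff ?gt_eqF// mul1r.
rewrite prodr_const (_ : #|_| = k.-1); last first.
  by rewrite -[k in RHS]card_ord -(cardC1 i); apply: eq_card.
have y0 : 0 <= k.-1%:R / k%:R :> R by rewrite divr_ge0.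
rewrite ki -powR_mulrn ?powR_ge0// powRAC powR_mulrn// -powRM ?invr_ge0 ?exprn_ge0//.
have -> : k%:R ^+ k = k%:R * k%:R ^+ k.-1 :> R by rewrite -exprS prednK.
by rewrite expr_div_n invfM mulrCA.
Qed.

Lemma simplex_max q : 0 < q -> (0 < k)%N ->
  exists2 y : 'I_k -> R, simplex y & forall z, simplex z -> Pk q z <= Pk q y.
Proof.
move=> q0 k0.
(* Row vectors carry the topology. The absolute values make [f] continuous everywhere, and on the
   simplex they change nothing. *)
pose f (v : 'rV[R]_k) : R := \sum_(i < k)
  (`|v ord0 i| `^ q * \prod_(j < k | j != i) (`|1 - v ord0 j| `^ q)).
have fE (v : 'rV[R]_k) : simplex (v ord0) -> f v = Pk q (v ord0).
  move=> sv; apply: eq_bigr => i _; rewrite ger0_norm; last by case: sv.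
  congr (_ * _); apply: eq_bigr => j _; rewrite ger0_norm// subr_ge0.
  by case/andP: (simplex_le1 j sv).
(* The simplex is a compact cube cut by a closed hyperplane. *)
pose A := ([set v : 'rV[R]_k | forall i, `[0, 1]%classic (v ord0 i)] `&`
  [set v | \sum_(i < k) v ord0 i = 1])%classic.
have AE (v : 'rV[R]_k) : A v <-> simplex (v ord0).
  split=> [[v1 v2]|sv]; first by split=> // i; have := v1 i; rewrite /= in_itv/= => /andP[].
  split=> [i|]; last by case: sv.
  by rewrite /= in_itv/=; exact: simplex_le1.
have cA : compact A.
  apply: compact_closedI.
    by apply: (@rV_compact R k (fun=> `[0, 1]%classic)) => i; exact: segment_compact.
  apply: (@preimage_closed _ _ (fun v : 'rV[R]_k => \sum_(i < k) v ord0 i) [set 1]%classic).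
    move=> v _.
    apply: continuous_big => // [|i _]; first exact: add_continuous.
    exact: coord_continuous.
  exact: closed_eq.
have cf : continuous f.
  apply: continuous_big => [|i _]; first exact: add_continuous.
  have c1 : continuous (fun v : 'rV[R]_k => `|v ord0 i| `^ q).
    move=> v; apply: (@continuous_comp _ _ _ (fun v : 'rV[R]_k => v ord0 i)
      (fun x : R => `|x| `^ q)); first exact: coord_continuous.
    exact: continuous_normr_powR.
  have c2 : continuous (fun v : 'rV[R]_k =>
      \prod_(j < k | j != i) `|1 - v ord0 j| `^ q).
    apply: continuous_big => [|j _]; first exact: mul_continuous.
    move=> v; apply: (@continuous_comp _ _ _ (fun v : 'rV[R]_k => v ord0 j)
      (fun x : R => `|1 - x| `^ q)); first exact: coord_continuous.
    apply: (@continuous_comp _ _ _ (fun x : R => 1 - x) (fun x : R => `|x| `^ q)).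
      exact: (@continuousB R R^o R^o (cst 1) id _ (@cst_continuous R^o R^o 1 _)).
    exact: continuous_normr_powR.
  by move=> v; exact: (continuousM (c1 v) (c2 v)).
have [|y Ay ymax] := @compact_EVT_max _ _ f A _ cA (continuous_subspaceT cf).
  exists (\row_i basisv R (Ordinal k0) i); apply/AE.
  rewrite (_ : _ ord0 = basisv R (Ordinal k0)); first exact: simplex_basisv.
  by apply/funext => i; rewrite mxE.
exists (y ord0); first by apply/AE; rewrite inE in Ay.
move=> z sz; have := ymax (\row_i z i).
have ze : (\row_i z i) ord0 = z by apply/funext => i; rewrite mxE.
have sy : simplex (y ord0) by apply/AE; rewrite inE in Ay.
rewrite !fE ?ze//; apply.
by rewrite inE; apply/AE; rewrite ze.
Qed.
End Simplex.

(** * Moving mass onto a zero coordinate *)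

Section Boundary.
Context {R : realType}.
Implicit Types (q b t : R).

(** The first term gains at least [c e ^ q], where [c = (1 - b) ^ q], while the other two lose at
    most a constant times [e]; as [q < 1], the gain wins for small [e]. *)
Lemma pair_value0_lt q b t : 0 < q < 1 -> 0 < b < 1 -> 0 <= t ->
  exists2 e, 0 < e < b & pair_value q t 0 b < pair_value q t e (b - e).
Proof.
move=> /andP[q0 q1] /andP[b0 b1] t0.
have b1' : 0 < 1 - b by rewrite subr_gt0.
pose c := (1 - b) `^ q.
have c0 : 0 < c by rewrite powR_gt0.
(* The two parts of [K] bound the linear losses in the second and third terms of [pair_value]. *)
pose K := b `^ q * (b^-1 + 1) + t * c.
have K0 : 0 < K.
  by rewrite ltr_pwDl ?mulr_ge0 ?(ltW c0)// mulr_gt0 ?powR_gt0// addr_gt0 ?invr_gt0.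
(* [d] solves [d ^ (1 - q) = c / (2 * K)], so [K e <= c e ^ q / 2] for [0 < e <= d]. *)
pose d := (c / (2 * K)) `^ (1 - q)^-1.
have d0 : 0 < d by rewrite powR_gt0 ?divr_gt0 ?mulr_gt0.
pose e := Num.min (b / 2) d.
have e0 : 0 < e by rewrite lt_min d0 divr_gt0.
have eb : e <= b / 2 by rewrite ge_min lexx.
have ed : e <= d by rewrite ge_min lexx orbT.
have eb' : e < b by lra.
exists e; first by rewrite e0.
clearbody e.
have He : K * e < c * e `^ q.
  have : e `^ (1 - q) <= c / (2 * K).
    have -> : c / (2 * K) = d `^ (1 - q).
      rewrite /d -powRrM mulVf ?gt_eqF ?subr_gt0// powRr1//.
      by rewrite divr_ge0 ?mulr_ge0 ?ltW.
    by apply: ge0_ler_powR; rewrite ?nnegrE ?subr_ge0 ?(ltW q1) ?(ltW e0) ?(ltW d0).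
  rewrite ler_pdivlMr ?mulr_gt0// => h.
  have -> : K * e = K * e `^ (1 - q) * e `^ q.
    by rewrite -mulrA -powR_split// subrK powRr1// ltW.
  by rewrite ltr_pM2r ?powR_gt0//; lra.
(* This gives linear lower bounds for powers of factors close to 1. *)
have pow_ge u : 0 < u <= 1 -> u <= u `^ q by move=> u1; apply: ger1_powR (ltW q1).
have mono u v : 0 <= u -> u <= v -> u `^ q <= v `^ q.
  move=> u0 uv; apply: ge0_ler_powR; rewrite ?nnegrE ?(ltW q0)//.
  exact: le_trans uv.
have h1 : c * e `^ q <= (e * (1 - (b - e))) `^ q.
  rewrite /c -powRM ?(ltW e0) ?(ltW b1')// mulrC; apply: mono.
    by rewrite mulr_ge0 ?ltW.
  by rewrite ler_pM2l//; lra.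
have e1 : 0 < 1 - e by lra.
have h2 : b `^ q * (1 - (b^-1 + 1) * e) <= ((b - e) * (1 - e)) `^ q.
  have ->: (b - e) * (1 - e) = b * ((1 - e / b) * (1 - e)).
    by field; rewrite gt_eqF.
  have eb1 : 0 < e / b by rewrite divr_gt0.
  have eb2 : 0 < 1 - e / b by rewrite subr_gt0 ltr_pdivrMr// mul1r.
  have p0 : 0 < (1 - e / b) * (1 - e) by rewrite mulr_gt0.
  rewrite powRM ?(ltW b0) ?(ltW p0)// ler_pM2l ?powR_gt0//.
  apply: (@le_trans _ _ ((1 - e / b) * (1 - e))); first by nra.
  by apply: pow_ge; rewrite p0 mulr_ile1 ?ltW//; lra.
have h3 : t * (c * (1 - e)) <= t * ((1 - e) * (1 - (b - e))) `^ q.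
  rewrite ler_wpM2l//.
  apply: (@le_trans _ _ (((1 - e) * (1 - b)) `^ q)); last first.
    by apply: mono; [rewrite mulr_ge0 ?ltW|rewrite ler_pM2l//; lra].
  rewrite powRM ?(ltW b1') ?(ltW e1)// -/c mulrC ler_pM2r// pow_ge// e1/=.
  by rewrite gerBl ltW.
rewrite /pair_value mul0r powR0 ?gt_eqF// subr0 mulr1 mul1r add0r -/c.
apply: lt_le_trans (lerD (lerD h1 h2) h3); rewrite -subr_gt0.
have -> : c * e `^ q + b `^ q * (1 - (b^-1 + 1) * e) + t * (c * (1 - e))
  - (b `^ q + t * c) = c * e `^ q - K * e by rewrite /K; ring.
by rewrite subr_gt0.
Qed.
End Boundary.

(** * The shape of a maximizer *)

Section Maximizer.
Context {R : realType} {k : nat}.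
Implicit Types (q : R) (y z : 'I_k -> R) (i j l : 'I_k).

Definition odds_sum q y i j : R :=
  \sum_(l < k | (l != i) && (l != j)) (y l / (1 - y l)) `^ q.

(** For the other coordinates, [y_l ^ q] is rewritten as [x_l ^ q (1 - y_l) ^ q], which needs
    [y_l < 1]. Nothing is divided by [1 - y_i] or [1 - y_j], so these two may reach 1, as they can
    after an exchange. *)
Lemma Pk_pair q y i j : i != j -> (forall l, 0 <= y l <= 1) ->
  (forall l, l != i -> l != j -> y l < 1) ->
  Pk q y = (\prod_(l < k | (l != i) && (l != j)) (1 - y l) `^ q) *
    pair_value q (odds_sum q y i j) (y i) (y j).
Proof.
move=> ij y01 y1; rewrite /Pk /pair_value /odds_sum.
have y0 l : 0 <= y l by case/andP: (y01 l).
have y0' l : 0 <= 1 - y l by rewrite subr_ge0; case/andP: (y01 l).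
have ji : j != i by rewrite eq_sym.
pose M := \prod_(l < k | (l != i) && (l != j)) (1 - y l) `^ q.
have Mi : \prod_(l < k | l != i) (1 - y l) `^ q = (1 - y j) `^ q * M.
  by rewrite (bigD1 j).
have Mj : \prod_(l < k | l != j) (1 - y l) `^ q = (1 - y i) `^ q * M.
  by rewrite (bigD1 i)//=; congr (_ * _); apply: eq_bigl => l; rewrite andbC.
have Mall : \prod_(l < k) (1 - y l) `^ q = (1 - y i) `^ q * (1 - y j) `^ q * M.
  by rewrite (bigD1 i)//= Mi mulrA.
rewrite (bigD1 i)//= Mi [X in _ + X](bigD1 j)//= Mj -/M !powRM//.
rewrite !mulrDr addrA; congr (_ + _ + _); [by rewrite mulrA mulrC|by rewrite mulrA mulrC|].
rewrite mulr_suml mulr_sumr; apply: eq_bigr => l /andP[li lj].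
have l1 : 0 < 1 - y l by rewrite subr_gt0 y1.
have -> : (y l) `^ q = (y l / (1 - y l)) `^ q * (1 - y l) `^ q.
  by rewrite -powRM ?divr_ge0// divfK// gt_eqF.
rewrite -mulrA.
have -> : (1 - y l) `^ q * \prod_(m < k | m != l) (1 - y m) `^ q =
    \prod_(m < k) (1 - y m) `^ q by rewrite [RHS](bigD1 l).
by rewrite Mall [RHS]mulrC -!mulrA.
Qed.

Definition update2 y i j a b : 'I_k -> R :=
  fun l => if l == i then a else if l == j then b else y l.

Lemma simplex_update2 y i j (a b : R) : i != j -> simplex y -> 0 <= a -> 0 <= b ->
  a + b = y i + y j -> simplex (update2 y i j a b).
Proof.
move=> ij [y0 y1] a0 b0 ab; split=> [l|].
  by rewrite /update2; case: ifP => // _; case: ifP.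
rewrite -y1 (bigD1 i)//= (bigD1 j)//= 1?eq_sym//.
rewrite [RHS](bigD1 i)//= [X in _ = _ + X](bigD1 j)//= 1?eq_sym//.
rewrite !addrA /update2 !eqxx eq_sym (negPf ij) ab; congr (_ + _).
by apply: eq_bigr => l /andP[/negPf -> /negPf ->].
Qed.

(** The exchange leaves [odds_sum] and the positive outer product unchanged, so maximality of [y]
    passes to the pair. *)
Lemma max_pair_value q y i j (a b : R) : i != j -> simplex y ->
  (forall z, simplex z -> Pk q z <= Pk q y) -> (forall l, y l < 1) ->
  0 <= a -> 0 <= b -> a + b = y i + y j ->
  pair_value q (odds_sum q y i j) a b <= pair_value q (odds_sum q y i j) (y i) (y j).
Proof.
move=> ij sy ymax y1 a0 b0 ab.
have sz := simplex_update2 ij sy a0 b0 ab.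
have := ymax _ sz.
rewrite (@Pk_pair q y i j)// => [|l]; last exact: simplex_le1.
have ezi : update2 y i j a b i = a by rewrite /update2 eqxx.
have ezj : update2 y i j a b j = b by rewrite /update2 eqxx eq_sym (negPf ij).
have ezl l : (l != i) && (l != j) -> update2 y i j a b l = y l.
  by rewrite /update2 => /andP[/negPf -> /negPf ->].
rewrite (@Pk_pair q _ i j)// => [|l|l li lj]; [|exact: simplex_le1|]; last first.
  by rewrite ezl ?li.
have -> : odds_sum q (update2 y i j a b) i j = odds_sum q y i j.
  by apply: eq_bigr => l lij; rewrite ezl.
rewrite (eq_bigr (fun l => (1 - y l) `^ q)) => [|l lij]; last by rewrite ezl.
rewrite ezi ezj.
rewrite ler_pM2l// prodr_gt0// => l _.
by rewrite powR_gt0// subr_gt0.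
Qed.

Lemma max_pos q y : 0 < q < 1 -> simplex y ->
  (forall z, simplex z -> Pk q z <= Pk q y) -> (forall l, y l < 1) ->
  forall i, 0 < y i.
Proof.
move=> q01 sy ymax y1 i; have [y0 ysum] := sy.
rewrite lt0r y0 andbT; apply/eqP => yi.
have [j yj] : exists j, 0 < y j.
  apply: contrapT => /forallNP h; move: ysum.
  rewrite big1 => [/esym/eqP|l _]; first by rewrite oner_eq0.
  by apply/eqP; rewrite eq_le y0 andbT leNgt; apply/negP/h.
have ij : i != j by apply: contraTneq yj => <-; rewrite yi ltxx.
have [||e /andP[e0 eb]] := @pair_value0_lt _ q (y j) (odds_sum q y i j) q01.
- by rewrite yj y1.
- by apply: sumr_ge0 => l _; exact: powR_ge0.
apply/negP; rewrite -leNgt.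
have := @max_pair_value q y i j e (y j - e) ij sy ymax y1.
by rewrite yi; apply; lra.
Qed.

(** If [y i] and [y j] differed, [hfun] would take one value at three points. If they agree for
    [i != j], the second-order condition contradicts [hslope > 0] at the larger of two points where
    [hfun] agrees. *)
Lemma max_two_values q y l i j : 0 < q < 1 -> simplex y ->
  (forall z, simplex z -> Pk q z <= Pk q y) -> (forall m, y m < 1) ->
  y l < y i -> y l < y j -> i = j.
Proof.
move=> q01 sy ymax y1 li lj; apply/eqP; apply/negPn/negP => ij.
have y0 := max_pos q01 sy ymax y1.
have q0 : 0 < q by case/andP: q01.
pose x m := y m / (1 - y m).
pose T := \sum_(m < k) x m `^ q.
have x0 m : 0 < x m by rewrite divr_gt0 ?subr_gt0.
have x_lt m n : (x m < x n) = (y m < y n).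
  rewrite /x ltr_pdivrMr ?subr_gt0// mulrAC ltr_pdivlMr ?subr_gt0//.
  by apply/idP/idP; lra.
have crit m n : m != n -> hfun q T (x m) = hfun q T (x n) /\
    (y m = y n -> hslope q T (x m) <= 0).
  move=> mn; have [||a b a0 b0 ab|] := @pair_max_critical _ q (y m) (y n)
    (odds_sum q y m n) q0.
  - by rewrite y0 y1.
  - by rewrite y0 y1.
  - exact: max_pair_value.
  (* Every pair thus yields the same [T], so the critical equations of different pairs concern one
     function. *)
  have -> : odds_sum q y m n + x m `^ q + x n `^ q = T.
    have nm : n != m by rewrite eq_sym.
    by rewrite /T (bigD1 m)//= (bigD1 n)//= addrA [RHS]addrC addrA.
  by split.
have hl m : y l < y m -> hfun q T (x l) = hfun q T (x m).
  move=> lm; apply: (crit _ _ _).1; apply: contraTneq lm => ->.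
  by rewrite ltxx.
have xlx m : y l < y m -> 0 < x l < x m by rewrite x0 x_lt.
have [yij|yij|yij] := ltgtP (y i) (y j).
- have := hfun_three_points q01 (xlx _ li) _ (hl _ li).
  by move=> /(_ (x j)); rewrite x_lt yij -(hl _ li) (hl _ lj) eqxx => /(_ isT).
- have := hfun_three_points q01 (xlx _ lj) _ (hl _ lj).
  by move=> /(_ (x i)); rewrite x_lt yij -(hl _ lj) (hl _ li) eqxx => /(_ isT).
have := hfun_eq_slope_gt0 q01 (xlx _ li) (hl _ li).
by rewrite ltNge (crit _ _ ij).2.
Qed.

Lemma Pk_one_large q i (a : R) : 0 < q -> (1 < k)%N ->
  0 <= a -> k.-1%:R * a <= 1 ->
  Pk q (fun j => if j == i then 1 - k.-1%:R * a else a)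
    = one_large q k.-1%:R a.
Proof.
move=> q0 k1 a0 Na; have k0 := ltnW k1.
set N := k.-1%:R; set y := fun j => _.
have N1 : 1 <= N :> R by rewrite ler1n; lia.
have N0 : 0 <= N :> R by rewrite ler0n.
have a1 : a <= 1 by apply: le_trans Na; rewrite ler_peMl.
have yi : y i = 1 - N * a by rewrite /y eqxx.
have yj j : j != i -> y j = a by rewrite /y => /negPf ->.
have card1 j : #|[pred l | l != j]| = k.-1.
  by rewrite -[k in RHS]card_ord -(cardC1 j); apply: eq_card.
have card2 j : j != i -> #|[pred l | (l != j) && (l != i)]| = k.-2.
  move=> ji; have := cardD1 i [pred l | l != j].
  rewrite card1 inE eq_sym ji add1n => -> /=.
  by apply: eq_card => l; rewrite !inE andbC.
rewrite /Pk (bigD1 i)//= yi (eq_bigr (fun=> (1 - a) `^ q)) => [|j ji]; last first.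
  by rewrite yj.
rewrite prodr_const card1 -powR_mulrn ?powR_ge0// -powRrM -/N; congr (_ + _).
(* For [j != i] the factor at [i] is [(N a) ^ q], which leaves [k - 2] factors [(1 - a) ^ q]. *)
rewrite (eq_bigr (fun=> a `^ q * ((N * a) `^ q * (1 - a) `^ (q * (N - 1))))).
  rewrite sumr_const card1 -[_ *+ _]mulr_natr -/N powRM//.
  have -> : a `^ (2 * q) = a `^ q * a `^ q.
    have qq : q + q != 0 by rewrite gt_eqF ?addr_gt0.
    by rewrite -powRD ?(negPf qq)// -mulr2n mulr_natl.
  have -> : N `^ (1 + q) = N * N `^ q.
    by rewrite powR_split ?powRr1// (lt_le_trans ltr01).
  ring.
move=> j ji; rewrite yj//; congr (_ * _).
rewrite (bigD1 i) 1?eq_sym//= yi opprB addrCA subrr addr0; congr (_ * _).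
rewrite (eq_bigr (fun=> (1 - a) `^ q)) => [|l /andP[_ li]]; last by rewrite yj.
rewrite prodr_const card2// -powR_mulrn ?powR_ge0// -powRrM.
by congr (_ `^ (_ * _)); rewrite /N -(subn1 k.-1) natrB//; lia.
Qed.

Lemma theta_one_large q : 0 < q -> (1 < k)%N ->
  theta q k = one_large q k.-1%:R (k.-1%:R + 1)^-1.
Proof.
move=> q0 k1; have k0 := ltnW k1.
rewrite -(Pk_unifv q k0) natr1 prednK//.
have kn0 : k%:R != 0 :> R by rewrite pnatr_eq0; lia.
have e : 1 - k.-1%:R * k%:R^-1 = k%:R^-1 :> R.
  by rewrite -subn1 natrB// mulrBl divff// mul1r subKr.
rewrite -(@Pk_one_large q (Ordinal k0))//.
- by congr Pk; apply/funext => j; rewrite e; case: ifP.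
- by rewrite -subr_ge0 e invr_ge0.
Qed.

(** Either some coordinate is 1, or all equal the smallest one, or exactly one exceeds it; the last
    case falls into the one-parameter family. *)
Lemma Pk_max q y : 2^-1 < q < 1 -> (0 < k)%N -> simplex y ->
  (forall z, simplex z -> Pk q z <= Pk q y) -> Pk q y <= Num.max 1 (theta q k).
Proof.
move=> /andP[q12 q1] k0 sy ymax; have q0 : 0 < q by lra.
have [[i yi]|noty1] := pselect (exists i, y i = 1).
  by rewrite (simplex_eq1 sy yi) Pk_basisv// le_max lexx.
have y1 m : y m < 1.
  have /andP[_] := simplex_le1 m sy; rewrite le_eqVlt => /predU1P[ym|//].
  by case: noty1; exists m.
have q01 : 0 < q < 1 by rewrite q0.
have y0 := max_pos q01 sy ymax y1.
have [l _ lmin] := @arg_minP _ _ _ (Ordinal k0) predT y isT.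
have [[i li]|eqy] := pselect (exists i, y l < y i); last first.
  have yE m : y m = y l.
    apply/eqP; rewrite eq_le lmin// andbT leNgt; apply/negP => lm.
    by apply: eqy; exists m.
  have : \sum_(m < k) y m = 1 by case: sy.
  rewrite (eq_bigr (fun=> y l)) => [|m _]; last exact: yE.
  rewrite sumr_const card_ord -[_ *+ k]mulr_natr => h.
  have -> : y = unifv R k.
    apply/funext => m; have kn0 : k%:R != 0 :> R by rewrite pnatr_eq0; lia.
    by rewrite yE -[LHS](mulfK kn0) h mul1r.
  by rewrite Pk_unifv// le_max lexx orbT.
have k1 : (1 < k)%N.
  have : l != i by apply: contraTneq li => ->; rewrite ltxx.
  by have := ltn_ord l; have := ltn_ord i; rewrite -val_eqE/=; lia.
have yE m : m != i -> y m = y l.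
  move=> mi; apply/eqP; rewrite eq_le lmin// andbT leNgt; apply/negP => lm.
  by move: mi; rewrite (max_two_values q01 sy ymax y1 lm li) eqxx.
have yi : y i = 1 - k.-1%:R * y l.
  have : \sum_(m < k) y m = 1 by case: sy.
  rewrite (bigD1 i)//= (eq_bigr (fun=> y l))//.
  rewrite sumr_const (_ : #|_| = k.-1) => [h|]; last first.
    by rewrite -[k in RHS]card_ord -(cardC1 i); apply: eq_card.
  by apply/eqP; rewrite mulr_natl eq_sym subr_eq h.
have -> : y = fun j => if j == i then 1 - k.-1%:R * y l else y l.
  by apply/funext => j; case: eqVneq => [->//|/yE].
have yi0 := y0 i.
rewrite Pk_one_large ?(ltW (y0 l))//; last by lra.
rewrite theta_one_large//; apply: one_large_le => //; first by rewrite ler1n; lia.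
(* The bound [y l < 1 / (N + 1)], with [N = k - 1], restates [y l < y i], as [y i = 1 - N * y l]. *)
rewrite y0 -[ltRHS]mul1r ltr_pdivlMr; last by rewrite natr1 ltr0n.
lra.
Qed.

End Maximizer.
Unset Implicit Arguments.

Theorem theorem3p1 (R : realType) (p : R) (k : nat) :
  1 < p -> p < 2 -> (1 <= k)%N ->
  [/\ (forall y : 'I_k -> R, simplex y ->
          Pk p^-1 y <= Num.max 1 (theta p^-1 k)),
      (forall i : 'I_k, Pk p^-1 (basisv R i) = 1),
      Pk p^-1 (unifv R k) = theta p^-1 k
    & w k p = Num.max 1 (theta p^-1 k)].
Proof.
move=> p1 p2 k0; have p0 : 0 < p by lra.
have q0 : 0 < p^-1 by rewrite invr_gt0.
have q12 : 2^-1 < p^-1 < 1 by rewrite ltf_pV2 ?posrE// p2 invf_lt1.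
have ub (y : 'I_k -> R) : simplex y -> Pk p^-1 y <= Num.max 1 (theta p^-1 k).
  have [z sz zmax] := simplex_max q0 k0.
  by move=> /zmax /le_trans; apply; exact: Pk_max zmax.
split=> //; [by move=> i; exact: Pk_basisv|exact: Pk_unifv|].
rewrite /w; set S := (X in sup X).
(* Both 1 and [theta] are values in [S], so their maximum, being an upper bound, is the supremum. *)
have Sub : ubound S (Num.max 1 (theta p^-1 k)) by move=> _ [y sy <-]; exact: ub.
have S1 : S 1.
  exists (basisv R (Ordinal k0)); first exact: simplex_basisv.
  exact: Pk_basisv.
have Stheta : S (theta p^-1 k).
  by exists (unifv R k); [exact: simplex_unifv|exact: Pk_unifv].
have hS : has_ubound S by exists (Num.max 1 (theta p^-1 k)).
apply/eqP; rewrite eq_le ge_sup//; last by exists 1.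
by rewrite ge_max !ub_le_sup.
Qed.
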